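(* Let $\alpha:I\to\mathbb{E}^4_1$ be a null Cartan helix with $\kappa_2,\kappa_3\neq0$ constant, and let $\lambda_0\in\mathbb{R}\setminus\{0\}$. (1) The general unit field (fields $\lambda T+\mu_0N+\nu_0B_1$ with $\lambda,\mu_0,\nu_0\in\mathbb{R}$ constant, $\nu_0\neq0$, $\mu_0^2+\nu_0^2=1$, subject to $\lambda=\nu_0\kappa_2$ and $\kappa_3r^2+\kappa_2^2r-\kappa_3=0$ for $r=\mu_0/\nu_0$) always yields exactly two (up to sign) axes $V_1,V_2$, corresponding to the two roots $r_1,r_2$ of the quadratic ($r_1r_2=-1$), and they are orthogonal: $\langle V_1,V_2\rangle=0$. (2) A Type I axis $V=\lambda_0T+N$ exists simultaneously if and only if $\kappa_3^2=\lambda_0^2(\lambda_0^2+\kappa_2^2)$. (3) When both hold, the curve admits at least three pairwise linearly independent axes in $T^\perp$, namely $V_1$, $V_2$ and $V$; all three are linearly independent.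
   Context: Minkowski space-time $\mathbb{E}^4_1$ is $\mathbb{R}^4$ with the metric $\langle x,y\rangle=-x_1y_1+x_2y_2+x_3y_3+x_4y_4$. A null Cartan curve is a smooth null curve $\alpha:I\to\mathbb{E}^4_1$ ($I$ an interval, $\alpha'\neq0$, $\langle\alpha',\alpha'\rangle=0$) parametrized by pseudo-arc length $s$ (so $\langle\alpha'',\alpha''\rangle=1$), together with its Cartan frame $\{T,N,B_1,B_2\}$, $T=\alpha'$, $N=\alpha''$, where $\langle T,T\rangle=\langle B_2,B_2\rangle=0$, $\langle N,N\rangle=\langle B_1,B_1\rangle=1$, $\langle T,B_2\rangle=1$, all other inner products of frame vectors vanish, $\det(T,N,B_1,B_2)=1$, and $$T'=N,\quad N'=\kappa_2B_1-B_2,\quad B_1'=\kappa_3T-\kappa_2N,\quad B_2'=-\kappa_3B_1$$ for smooth functions $\kappa_2,\kappa_3:I\to\mathbb{R}$ (the Cartan curvatures). Primes denote $d/ds$. A null Cartan helix is a null Cartan curve with $\kappa_2,\kappa_3$ constant and $\kappa_3\neq0$. $T^\perp=\{X:\langle X,T\rangle=0\}=\operatorname{span}\{T,N,B_1\}$. In this statement an ''axis'' is a unit field $V\in T^\perp$ with constant coefficients in $\{T,N,B_1\}$ for which there are a fixed vector $W\in\mathbb{E}^4_1\setminus\{0\}$ and a constant $c_0\in\mathbb{R}$ with $\langle V,W\rangle=c_0$ for all $s$. A Type I field is one of the form $\lambda_0T+N$. *)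

(* Defs.v *)
(* MathComp / MathComp-Analysis, over an arbitrary [R : realType]. *)
From mathcomp Require Import all_boot all_order all_algebra.
From mathcomp Require Import all_classical all_reals all_analysis.

Set Implicit Arguments.
Unset Strict Implicit.
Unset Printing Implicit Defensive.
Import Order.TTheory GRing.Theory Num.Theory.
Import numFieldNormedType.Exports.

Local Open Scope ring_scope.
Local Open Scope classical_set_scope.

Notation "''E41[' R ]" := 'rV[R]_4 (format "''E41[' R ]").

Definition mink (R : realType) (x y : 'E41[R]) : R :=
  - (x 0 0 * y 0 0) + x 0 1 * y 0 1 + x 0 2 * y 0 2 + x 0 3 * y 0 3.

(* Maps on an interval [I] are represented by total maps on [R]; only their
   values on [I] matter.  At an endpoint belonging to [I] (if any) the two-sided
   derivatives are those of an extension beyond [I], and they agree with the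
   one-sided derivatives from inside [I]; every smooth map on [I] extends. *)
Definition smooth_on (R : realType) (V : normedModType R) (I : interval R)
    (f : R -> V) : Prop :=
  forall (n : nat) (s : R), s \in I -> derivable (derive1n n f) s 1.

Definition nondegenerate (R : realType) (I : interval R) : Prop :=
  exists a b : R, [/\ a < b, a \in I & b \in I].

(* The pseudo-arc length condition is the conjunction of [ncc_N]
   (which says N = alpha'') and [ncc_NN]. *)
Record null_cartan_curve (R : realType) (I : interval R)
    (alpha T N B1 B2 : R -> 'E41[R]) (k2 k3 : R -> R) : Prop := NullCartanCurve {
  ncc_nondeg : nondegenerate I;
  ncc_smooth : smooth_on I alpha;
  ncc_smooth_k2 : smooth_on I (k2 : R -> R^o);
  ncc_smooth_k3 : smooth_on I (k3 : R -> R^o);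
  ncc_T : forall s, s \in I -> is_derive s 1 alpha (T s);
  ncc_T_neq0 : forall s, s \in I -> T s != 0;
  ncc_TT : forall s, s \in I -> mink (T s) (T s) = 0;
  ncc_B2B2 : forall s, s \in I -> mink (B2 s) (B2 s) = 0;
  ncc_NN : forall s, s \in I -> mink (N s) (N s) = 1;
  ncc_B1B1 : forall s, s \in I -> mink (B1 s) (B1 s) = 1;
  ncc_TB2 : forall s, s \in I -> mink (T s) (B2 s) = 1;
  ncc_TN : forall s, s \in I -> mink (T s) (N s) = 0;
  ncc_TB1 : forall s, s \in I -> mink (T s) (B1 s) = 0;
  ncc_NB1 : forall s, s \in I -> mink (N s) (B1 s) = 0;
  ncc_NB2 : forall s, s \in I -> mink (N s) (B2 s) = 0;
  ncc_B1B2 : forall s, s \in I -> mink (B1 s) (B2 s) = 0;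
  ncc_det : forall s, s \in I ->
    \det (\matrix_(i < 4) [:: T s; N s; B1 s; B2 s]`_i) = 1;
  ncc_N : forall s, s \in I -> is_derive s 1 T (N s);
  ncc_N' : forall s, s \in I -> is_derive s 1 N (k2 s *: B1 s - B2 s);
  ncc_B1' : forall s, s \in I -> is_derive s 1 B1 (k3 s *: T s - k2 s *: N s);
  ncc_B2' : forall s, s \in I -> is_derive s 1 B2 (- (k3 s *: B1 s)) }.

Definition null_cartan_helix (R : realType) (I : interval R)
    (alpha T N B1 B2 : R -> 'E41[R]) (k2 k3 : R) : Prop :=
  null_cartan_curve I alpha T N B1 B2 (fun=> k2) (fun=> k3) /\ k3 != 0.

Definition field_of (R : realType) (T N B1 : R -> 'E41[R]) (l m n : R) :
    R -> 'E41[R] :=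
  fun s => l *: T s + m *: N s + n *: B1 s.

Definition eq_field (R : realType) (I : interval R) (V V' : R -> 'E41[R]) : Prop :=
  forall s, s \in I -> V s = V' s.

Definition eq_field_up_to_sign (R : realType) (I : interval R)
    (V V' : R -> 'E41[R]) : Prop :=
  eq_field I V V' \/ eq_field I V (fun s => - V' s).

Definition is_axis (R : realType) (I : interval R) (T N B1 : R -> 'E41[R])
    (V : R -> 'E41[R]) : Prop :=
  [/\ exists l m n : R, eq_field I V (field_of T N B1 l m n),
      forall s, s \in I -> mink (V s) (T s) = 0,
      forall s, s \in I -> mink (V s) (V s) = 1 &
      exists (W : 'E41[R]) (c0 : R),
        W != 0 /\ forall s, s \in I -> mink (V s) W = c0].

Definition type_I_field (R : realType) (T N : R -> 'E41[R]) (l0 : R) :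
    R -> 'E41[R] :=
  fun s => l0 *: T s + N s.

Definition root_eq (R : realType) (k2 k3 r : R) : Prop :=
  k3 * r ^+ 2 + k2 ^+ 2 * r - k3 = 0.

(* [V] is a general unit field whose ratio [mu0 / nu0] is [r]. *)
Definition general_unit_field (R : realType) (I : interval R)
    (T N B1 : R -> 'E41[R]) (k2 k3 r : R) (V : R -> 'E41[R]) : Prop :=
  exists l m0 n0 : R,
    [/\ n0 != 0, m0 ^+ 2 + n0 ^+ 2 = 1, l = n0 * k2, r = m0 / n0 &
        root_eq k2 k3 r] /\
    eq_field I V (field_of T N B1 l m0 n0).

(* Main.v *)
Require Import Defs.
From mathcomp Require Import all_boot all_order all_algebra.
From mathcomp Require Import all_classical all_reals all_analysis.
From mathcomp Require Import ring lra.

Set Implicit Arguments.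
Unset Strict Implicit.
Unset Printing Implicit Defensive.
Import Order.TTheory GRing.Theory Num.Theory.
Import numFieldNormedType.Exports.

Local Open Scope ring_scope.
Local Open Scope classical_set_scope.

(** Fix a vector [W] and follow its four heights [x = <T,W>], [y = <N,W>],
    [z = <B1,W>], [w = <B2,W>] along the curve.  The frame equations turn them
    into a solution of a linear system with constant coefficients, so that
    differentiating a height [p x + q y + u z + v w] amounts to a linear map on
    the covector [(p, q, u, v)] ([is_derive_mink_comb]).  The characteristic
    polynomial of this map is [X^4 + k2^2 X^2 - k3^2], and its roots in [X^2]
    are [r k3], where [r] runs over the two roots of
    [k3 r^2 + k2^2 r - k3 = 0].

    General unit fields.  For a root [r], the height [f] of [k2 T + r N + B1]
    satisfies [f'' = r k3 f].  A nonzero [W] with [f = f' = 0] at one point of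
    [I] then has [f = 0] on all of [I], by uniqueness for a linear equation of
    order two ([ode2_zero]); this is [root_axis].  Normalising the field to
    unit length leaves only its sign free ([general_unit_fieldE]), so the two
    roots give two fields up to sign, and [r1 r2 = -1] is exactly their
    orthogonality.

    Type I fields.  Let [f = l x + y] be the height of [l T + N], and write
    [f2], [f3], [f4] for its derivatives of order 2, 3, 4.  If [f] is constant,
    the equation [f4 + k2^2 f2 - k3^2 f = 0] forces [f = 0]; eliminating [y],
    [w] and [z] from [f = f' = f2 = f3 = 0] leaves
    [(k3^2 - l^2 (l^2 + k2^2)) x = 0], where [x = 0] would give [W = 0]
    ([type_I_axis_curvature]).  Conversely the curvature relation says that
    [- l] is a root of the characteristic polynomial, which is then
    [(X + l) (X - l) (X^2 + l^2 + k2^2)].  The height [f] vanishes on the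
    eigenvector for [- l], hence satisfies the equation of order three given by
    the last two factors, and [f = f' = f2 = 0] at one point propagates
    through these factors one after the other ([type_I_axis]).

    Independence.  In the basis [T, N, B1] the determinant of the directions
    [(k2, r1, 1)], [(k2, r2, 1)] and [(l, 1, 0)] is [l (r1 - r2)]. *)

(** * Uniqueness for linear differential equations on an interval *)

Lemma itv_convex (R : realType) (I : interval R) (a b s : R) :
  a \in I -> b \in I -> a <= s -> s <= b -> s \in I.
Proof.
case: I => l u; rewrite !itv_boundlr => /andP[la _] /andP[_ bu] as_ sb.
apply/andP; split.
  by apply: le_trans la _; rewrite bnd_simp.
by apply: le_trans _ bu; rewrite bnd_simp.
Qed.

Lemma MVT_itv (R : realType) (I : interval R) (f df : R -> R) (x y : R) :
  (forall s, s \in I -> is_derive s 1 f (df s)) ->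
  x \in I -> y \in I -> x <= y ->
  exists2 c, c \in I & f y - f x = df c * (y - x).
Proof.
move=> fd xI yI xy.
have sub s : s \in `[x, y]%R -> s \in I.
  by rewrite in_itv/= => /andP[xs sy]; apply: itv_convex xI yI xs sy.
have [||c cxy ->] := @MVT_segment R f df x y xy.
- by move=> s /subset_itv_oo_cc sxy; apply/fd/sub.
- apply: derivable_within_continuous => s sxy.
  by have [] := fd s (sub s sxy).
- by exists c => //; apply: sub.
Qed.

(** The product of the energy [E] with [exp (- K s)] decreases to the right of
    [s0], and its product with [exp (K s)] increases to the left of [s0]; both
    vanish at [s0]. *)
Lemma gronwall_vanish (R : realType) (I : interval R) (E e : R -> R) (K s0 : R) :
  (forall s, s \in I -> is_derive s 1 E (e s)) ->
  (forall s, s \in I -> `|e s| <= K * E s) ->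
  s0 \in I -> E s0 = 0 -> forall s, s \in I -> E s <= 0.
Proof.
move=> Ed eK s0I E0 s sI.
have hd (k : R) t : t \in I ->
    is_derive t 1 (fun x => E x * expR (k * x)) ((e t + k * E t) * expR (k * t)).
  move=> tI; have Edt := Ed t tI.
  have kd : is_derive t 1 (fun x : R => k * x) k.
    have -> : (fun x : R => k * x) = k \*: id by [].
    by apply: is_derive_eq; rewrite /GRing.scale/= mulr1.
  have xd := is_derive1_comp (is_derive_expR (k * t)) kd.
  apply: is_derive_eq (is_deriveM Edt xd) _.
  by rewrite /GRing.scale/=; ring.
have [s0s|ss0] := leP s0 s.
  have [c cI] := MVT_itv (hd (- K)) s0I sI s0s.
  rewrite E0 mul0r subr0 => h.
  have : E s * expR (- K * s) <= 0.
    rewrite h mulr_le0_ge0 ?subr_ge0// mulr_le0_ge0 ?expR_ge0//.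
    by rewrite mulNr subr_le0 (le_trans (ler_norm _)) ?eK.
  by rewrite pmulr_lle0 ?expR_gt0.
have [c cI] := MVT_itv (hd K) sI s0I (ltW ss0).
rewrite E0 mul0r sub0r => h.
have : 0 <= - (E s * expR (K * s)).
  rewrite h !mulr_ge0 ?subr_ge0 ?expR_ge0 ?(ltW ss0)//.
  by rewrite -lerBlDr sub0r lerNl (le_trans _ (eK c cI))// -normrN ler_norm.
by rewrite oppr_ge0 pmulr_lle0 ?expR_gt0.
Qed.

(** Written as a system [f' = g], [g' = c f], so that [f] need not be
    differentiated twice.  The energy [f^2 + g^2] has derivative
    [2 (1 + c) f g], bounded by [|1 + c|] times the energy. *)
Lemma ode2_zero (R : realType) (I : interval R) (f g : R -> R) (c s0 : R) :
  (forall s, s \in I -> is_derive s 1 f (g s)) ->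
  (forall s, s \in I -> is_derive s 1 g (c * f s)) ->
  s0 \in I -> f s0 = 0 -> g s0 = 0 -> forall s, s \in I -> f s = 0.
Proof.
move=> fd gd s0I f0 g0 s sI.
pose E x := f x * f x + g x * g x.
pose e x := (2 * (1 + c)) * (f x * g x).
have Ed t : t \in I -> is_derive t 1 E (e t).
  move=> tI; have ft := fd t tI; have gt := gd t tI.
  apply: is_derive_eq (is_deriveD (is_deriveM ft ft) (is_deriveM gt gt)) _.
  by rewrite /GRing.scale/= /e; ring.
have eK t : t \in I -> `|e t| <= `|1 + c| * E t.
  move=> _; rewrite /e /E -[2 * _ * _]mulrA mulrCA normrM ler_wpM2l// ler_norml.
  have := sqr_ge0 (f t - g t); have := sqr_ge0 (f t + g t).
  by rewrite sqrrB sqrrD; lra.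
have := gronwall_vanish Ed eK s0I.
rewrite {1}/E f0 g0 mul0r addr0 => /(_ erefl s sI).
rewrite /E -!expr2 => h.
apply/eqP; rewrite -sqrf_eq0 eq_le sqr_ge0 andbT.
by apply: le_trans h; rewrite lerDl sqr_ge0.
Qed.

(** The interval is open because at an endpoint the two-sided derivative would
    also see values of [f] outside it. *)
Lemma derive_eq0_of_const_oo (R : realType) (f : R -> R) (a b c s df : R) :
  (forall t, t \in `]a, b[%R -> f t = c) -> s \in `]a, b[%R ->
  is_derive s 1 f df -> df = 0.
Proof.
move=> fc sab [fs <-]; rewrite (@near_eq_derive _ _ _ f (cst c)).
  by rewrite derive_cst.
by apply: filterS (near_in_itvoo sab) => t tab; rewrite fc.
Qed.

(** * The Minkowski product *)

Section Minkowski.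
Context {R : realType}.
Implicit Types x y z W : 'E41[R].

Lemma minkC x y : mink x y = mink y x.
Proof. by rewrite /mink; ring. Qed.

Lemma minkDl x y z : mink (x + y) z = mink x z + mink y z.
Proof. by rewrite /mink !mxE; ring. Qed.

Lemma minkZl a x y : mink (a *: x) y = a * mink x y.
Proof. by rewrite /mink !mxE; ring. Qed.

Lemma minkNl x y : mink (- x) y = - mink x y.
Proof. by rewrite /mink !mxE; ring. Qed.

Lemma mink0l x : mink 0 x = 0.
Proof. by rewrite /mink !mxE; ring. Qed.

Lemma is_derive_mink (F : R -> 'E41[R]) (dF : 'E41[R]) (s : R) W :
  is_derive s 1 F dF -> is_derive s 1 (fun t => mink (F t) W) (mink dF W).
Proof.
move=> [Fs FdF].
have Fd i : is_derive s 1 (fun t => F t 0 i) (dF 0 i).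
  split; first by have /derivable_mxP := Fs; apply.
  by rewrite -FdF derive_mx// mxE.
have Md i := is_deriveM (Fd i) (is_derive_cst (W 0 i) s 1).
apply: is_derive_eq (is_deriveD (is_deriveD (is_deriveD
  (is_deriveN (Md 0)) (Md 1)) (Md 2)) (Md 3)) _.
by rewrite /mink /GRing.scale/=; ring.
Qed.

(** Nondegeneracy: lowering the index of [W] turns the four conditions into a
    linear system whose matrix has the vectors [e i] as rows. *)
Lemma mink_basis_eq0 (e : 'I_4 -> 'E41[R]) W :
  \det (\matrix_(i < 4) e i) != 0 -> (forall i, mink (e i) W = 0) -> W = 0.
Proof.
move=> De eW; set M := \matrix_i e i in De.
pose w : 'cV[R]_4 := \col_i (if i == 0 then - W 0 i else W 0 i).
have Mw : M *m w = 0.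
  apply/matrixP => i j; rewrite ord1 !mxE -[RHS](eW i) /mink.
  rewrite !big_ord_recr big_ord0 /= add0r !mxE /= mulrN.
  congr (_ + _ + _ + _); first congr (- (e i 0 _ * W 0 _));
    try congr (e i 0 _ * W 0 _); exact/val_inj.
have w0 : w = 0.
  have Mu : M \in unitmx by rewrite unitmxE unitfE.
  by rewrite -(mulKmx Mu w) Mw mulmx0.
apply/rowP => i; have /colP/(_ i) := w0; rewrite !mxE.
by case: eqP => // _ /eqP; rewrite oppr_eq0 => /eqP.
Qed.

End Minkowski.

(** * Heights along a null Cartan curve with constant curvatures *)

Definition frame_comb (R : realType) (T N B1 B2 : R -> 'E41[R])
    (p q u v s : R) : 'E41[R] :=
  p *: T s + q *: N s + u *: B1 s + v *: B2 s.

Section Helix.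
Context (R : realType) (I : interval R).
Context (alpha T N B1 B2 : R -> 'E41[R]) (k2 k3 : R).
Hypothesis curve : null_cartan_curve I alpha T N B1 B2 (fun=> k2) (fun=> k3).
Local Notation comb := (frame_comb T N B1 B2).

Lemma mink_comb p q u v p' q' u' v' s : s \in I ->
  mink (comb p q u v s) (comb p' q' u' v' s) = p * v' + q * q' + u * u' + v * p'.
Proof.
move=> sI; have c := curve.
rewrite /frame_comb !minkDl !minkZl ![mink _ (_ + _)]minkC !minkDl !minkZl.
rewrite [mink (N s) (T s)]minkC [mink (B1 s) (T s)]minkC.
rewrite [mink (B2 s) (T s)]minkC [mink (B1 s) (N s)]minkC.
rewrite [mink (B2 s) (N s)]minkC [mink (B2 s) (B1 s)]minkC.
rewrite (ncc_TT c sI) (ncc_TN c sI) (ncc_TB1 c sI) (ncc_TB2 c sI) (ncc_NN c sI).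
rewrite (ncc_NB1 c sI) (ncc_NB2 c sI) (ncc_B1B1 c sI) (ncc_B1B2 c sI).
by rewrite (ncc_B2B2 c sI); ring.
Qed.

(** The transpose of the frame system acting on covectors; all later
    derivatives of heights are iterates of this map. *)
Lemma is_derive_mink_comb W p q u v s : s \in I ->
  is_derive s 1 (fun t => mink (comb p q u v t) W)
    (mink (comb (k3 * u) (p - k2 * u) (k2 * q - k3 * v) (- q) s) W).
Proof.
move=> sI; apply: is_derive_mink.
have Td := ncc_N curve sI; have Nd := ncc_N' curve sI.
have B1d := ncc_B1' curve sI; have B2d := ncc_B2' curve sI.
apply: is_derive_eq (is_deriveD (is_deriveD (is_deriveD
  (is_deriveZ p Td) (is_deriveZ q Nd)) (is_deriveZ u B1d)) (is_deriveZ v B2d)) _.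
by rewrite /frame_comb; apply/rowP => i; rewrite !mxE; ring.
Qed.

Lemma frame_mink_eq0 W s : s \in I ->
  mink (T s) W = 0 -> mink (N s) W = 0 -> mink (B1 s) W = 0 ->
  mink (B2 s) W = 0 -> W = 0.
Proof.
move=> sI TW NW B1W B2W.
apply: (@mink_basis_eq0 _ (fun i => [:: T s; N s; B1 s; B2 s]`_i)).
  by rewrite (ncc_det curve sI) oner_neq0.
by case=> [[|[|[|[|]]]]].
Qed.

Lemma field_of_comb p q u s : field_of T N B1 p q u s = comb p q u 0 s.
Proof. by rewrite /field_of /frame_comb scale0r addr0. Qed.

Lemma type_I_field_of l : type_I_field T N l = field_of T N B1 l 1 0.
Proof.
by apply/funext => s; rewrite /type_I_field /field_of scale1r scale0r addr0.
Qed.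

Lemma is_axis_field_of p q u W c0 :
  q ^+ 2 + u ^+ 2 = 1 -> W != 0 ->
  (forall s, s \in I -> mink (comb p q u 0 s) W = c0) ->
  is_axis I T N B1 (field_of T N B1 p q u).
Proof.
move=> qu W0 cW; split; first by exists p, q, u.
- move=> s sI; have -> : T s = comb 1 0 0 0 s.
    by rewrite /frame_comb scale1r !scale0r !addr0.
  by rewrite field_of_comb mink_comb//; ring.
- by move=> s sI; rewrite field_of_comb mink_comb// -qu; ring.
- by exists W, c0; split=> // s sI; rewrite field_of_comb cW.
Qed.

Lemma ratio_combE n r : comb (n * k2) (n * r) n 0 =
  (fun s => n *: comb k2 r 1 0 s).
Proof.
by apply/funext => s; rewrite /frame_comb; apply/rowP => i; rewrite !mxE; ring.
Qed.

(** * Axes among the general unit fields and the Type I fields *)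

(** The direction [k2 T + r N + B1] differentiates to
    [k3 T + r k2 B1 - r B2], which differentiates to [r k3] times the initial
    direction; the root equation is used for the coefficient of [N]. *)
Lemma root_axis r n : root_eq k2 k3 r -> (n * r) ^+ 2 + n ^+ 2 = 1 ->
  is_axis I T N B1 (field_of T N B1 (n * k2) (n * r) n).
Proof.
move=> rr nr; have [s0 [_ [_ s0I _]]] := ncc_nondeg curve.
(* The heights of this vector at [s0] are [(0, 1, - r, - k2 r)]: they make the
   height of the field and its first derivative vanish there. *)
pose W := comb (- (k2 * r)) 1 (- r) 0 s0.
have NW : mink (N s0) W = 1.
  have -> : N s0 = comb 0 1 0 0 s0.
    by rewrite /frame_comb scale1r !scale0r add0r !addr0.
  by rewrite mink_comb//; ring.
apply: (@is_axis_field_of _ _ _ W 0 nr).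
  by apply: contra_eq_neq NW => ->; rewrite minkC mink0l eq_sym oner_neq0.
move=> s sI; rewrite ratio_combE minkZl.
suff -> : mink (comb k2 r 1 0 s) W = 0 by rewrite mulr0.
move: s sI.
apply: (@ode2_zero R I _ (fun s => mink (comb k3 0 (k2 * r) (- r) s) W) (r * k3) s0) => //.
- move=> s sI; apply: is_derive_eq (is_derive_mink_comb W _ _ _ _ sI) _.
  by rewrite !mulr1 subrr mulr0 subr0.
- move=> s sI; apply: is_derive_eq (is_derive_mink_comb W _ _ _ _ sI) _.
  have rE : k3 - k2 * (k2 * r) = r * k3 * r.
    by apply/eqP; rewrite -subr_eq0 -oppr_eq0; apply/eqP; rewrite -[RHS]rr; ring.
  rewrite -minkZl /frame_comb mulr0 sub0r mulrN opprK rE oppr0.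
  by congr mink; apply/rowP => i; rewrite !mxE; ring.
- by rewrite mink_comb//; ring.
- by rewrite mink_comb//; ring.
Qed.

(** Write [f] for the height of [l T + N].  The combination [h = f' - l f]
    satisfies [h'' = - (l^2 + k2^2) h] thanks to the curvature relation.  For a
    vector [W] with [f = h = h' = 0] at one point, [h] vanishes on [I], so
    [f' = l f], and [f] vanishes in turn. *)
Lemma type_I_axis l : k3 != 0 -> k3 ^+ 2 = l ^+ 2 * (l ^+ 2 + k2 ^+ 2) ->
  is_axis I T N B1 (type_I_field T N l).
Proof.
move=> k3_neq0 k3E; have [s0 [_ [_ s0I _]]] := ncc_nondeg curve.
(* The heights of [W] at [s0] are those of the eigenvector for [- l]:
   [x = 1], [y = - l], then [z = c] from [h' = 0] and [w] from [h = 0]. *)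
pose c := - (k2 * k3 + l * (l ^+ 2 + k2 ^+ 2)) / k3.
have k3c : k3 * c = - (k2 * k3 + l * (l ^+ 2 + k2 ^+ 2)).
  by rewrite mulrC divfK.
pose W := comb (k2 * c - l ^+ 2) (- l) c 1 s0.
have TW : mink (T s0) W = 1.
  have -> : T s0 = comb 1 0 0 0 s0.
    by rewrite /frame_comb scale1r !scale0r !addr0.
  by rewrite mink_comb//; ring.
(* The covectors below are those of [h] and of its derivative. *)
have h0 s : s \in I -> mink (comb (- l ^+ 2) 0 k2 (-1) s) W = 0.
  move: s; apply: (@ode2_zero R I _
    (fun s => mink (comb (k2 * k3) (- (l ^+ 2 + k2 ^+ 2)) k3 0 s) W)
    (- (l ^+ 2 + k2 ^+ 2)) s0) => //.
  - move=> s sI; apply: is_derive_eq (is_derive_mink_comb W _ _ _ _ sI) _.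
    by rewrite /frame_comb; congr mink; apply/rowP => i; rewrite !mxE; ring.
  - move=> s sI; apply: is_derive_eq (is_derive_mink_comb W _ _ _ _ sI) _.
    rewrite -minkZl /frame_comb -expr2 k3E.
    by congr mink; apply/rowP => i; rewrite !mxE; ring.
  - by rewrite mink_comb//; ring.
  - by rewrite mink_comb// k3c; ring.
rewrite type_I_field_of; apply: (@is_axis_field_of _ _ _ W 0).
- by rewrite expr1n expr0n addr0.
- by apply: contra_eq_neq TW => ->; rewrite minkC mink0l eq_sym oner_neq0.
have fd s : s \in I -> is_derive s 1 (fun s => mink (comb l 1 0 0 s) W)
    (l * mink (comb l 1 0 0 s) W).
  move=> sI; apply: is_derive_eq (is_derive_mink_comb W _ _ _ _ sI) _.
  rewrite -[RHS]addr0 -[X in _ = _ + X](h0 s sI) -minkZl -minkDl /frame_comb.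
  by congr mink; apply/rowP => i; rewrite !mxE; ring.
(* [f' = l f] is solved through the second derivative, equal to [l^2 f]. *)
apply: (@ode2_zero R I _ (fun s => l * mink (comb l 1 0 0 s) W) (l ^+ 2) s0) => //.
- move=> s sI; apply: is_derive_eq (is_deriveZ l (fd s sI)) _.
  by rewrite /GRing.scale/=; ring.
- by rewrite mink_comb//; ring.
- by rewrite mink_comb//; ring.
Qed.

(** Four derivatives are taken at an interior point: the fourth one serves to
    show that the constant is zero, the first three to eliminate. *)
Lemma type_I_axis_curvature l : k3 != 0 ->
  is_axis I T N B1 (type_I_field T N l) ->
  k3 ^+ 2 = l ^+ 2 * (l ^+ 2 + k2 ^+ 2).
Proof.
move=> k3_neq0 [_ _ _ [W [c0 [W0 VW]]]].
have [a [b [ab aI bI]]] := ncc_nondeg curve.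
have sub s : s \in `]a, b[%R -> s \in I.
  by rewrite in_itv/= => /andP[as_ sb]; apply: itv_convex aI bI (ltW as_) (ltW sb).
have step p q u v c : (forall t, t \in `]a, b[%R -> mink (comb p q u v t) W = c) ->
    forall t, t \in `]a, b[%R ->
    mink (comb (k3 * u) (p - k2 * u) (k2 * q - k3 * v) (- q) t) W = 0.
  move=> hc t tab.
  exact: derive_eq0_of_const_oo hc tab (is_derive_mink_comb W _ _ _ _ (sub t tab)).
have h0 t : t \in `]a, b[%R -> mink (comb l 1 0 0 t) W = c0.
  by move=> /sub tI; rewrite -field_of_comb -type_I_field_of VW.
have h1 := step _ _ _ _ _ h0; have h2 := step _ _ _ _ _ h1.
have h3 := step _ _ _ _ _ h2; have h4 := step _ _ _ _ _ h3.
have [s sab] : exists s, s \in `]a, b[%R by exists ((a + b) / 2); exact: mid_in_itvoo.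
move: (h0 s sab) (h1 s sab) (h2 s sab) (h3 s sab) (h4 s sab).
rewrite /frame_comb !minkDl !minkZl.
have := frame_mink_eq0 (W := W) (sub s sab).
move: (mink (T s) W) (mink (N s) W) (mink (B1 s) W) (mink (B2 s) W).
move=> x y z w W_eq0 e0 e1 e2 e3 e4.
(* From [e0] to [e4]: the height of the field and its first four derivatives. *)
have c00 : c0 = 0.
  have k2e2 := congr1 ( *%R (k2 ^+ 2)) e2.
  have k3e0 := congr1 ( *%R (k3 ^+ 2)) e0.
  have /eqP : k3 ^+ 2 * c0 = 0 by lra.
  by rewrite mulf_eq0 expf_eq0/= (negPf k3_neq0) => /eqP.
have yE : y = - (l * x) by lra.
have wE : w = l * y + k2 * z by lra.
subst w y c0; have le2 := congr1 ( *%R l) e2.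
(* This is [e3 - l e2], in which [z] cancels. *)
have /eqP : (k3 ^+ 2 - l ^+ 2 * (l ^+ 2 + k2 ^+ 2)) * x = 0 by lra.
rewrite mulf_eq0 subr_eq0 => /orP[/eqP//|/eqP x0].
subst x; have /eqP : k3 * z = 0 by lra.
rewrite mulf_eq0 (negPf k3_neq0)/= => /eqP z0; subst z.
by move/eqP: W0; case; apply: W_eq0; lra.
Qed.

(** Pairing a vanishing combination with [B2], [N] and [B1] reads off its
    coordinates along [T], [N] and [B1]. *)
Lemma ratio_fields_type_I_free r1 r2 n1 n2 l s :
  s \in I -> r1 != r2 -> n1 != 0 -> n2 != 0 ->
  l != 0 ->
  free [:: field_of T N B1 (n1 * k2) (n1 * r1) n1 s;
           field_of T N B1 (n2 * k2) (n2 * r2) n2 s; type_I_field T N l s].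
Proof.
move=> sI r12 n10 n20 l0.
set v1 := field_of _ _ _ _ _ _ s; set v2 := field_of _ _ _ _ _ _ s.
set v3 := type_I_field _ _ _ s; apply/(freeP (X := [tuple v1; v2; v3])) => k.
rewrite /v1 /v2 /v3 => {v1 v2 v3}.
rewrite type_I_field_of !field_of_comb !big_ord_recl big_ord0 addr0 /=.
set k0' := k _; set k1' := k _; set k2' := k _ => sum0.
have coef p q u v : k0' * mink (comb (n1 * k2) (n1 * r1) n1 0 s) (comb p q u v s) +
   (k1' * mink (comb (n2 * k2) (n2 * r2) n2 0 s) (comb p q u v s) +
   k2' * mink (comb l 1 0 0 s) (comb p q u v s)) = 0.
  by rewrite -!minkZl -!minkDl sum0 mink0l.
have := coef 0 0 0 1; have := coef 0 1 0 0; have := coef 0 0 1 0.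
rewrite !mink_comb// => eB1 eN eT.
have k20 : k2' = 0.
  have k2eB1 := congr1 ( *%R k2) eB1.
  have /eqP : k2' * l = 0 by lra.
  by rewrite mulf_eq0 (negPf l0) orbF => /eqP.
have k00 : k0' = 0.
  have r2eB1 := congr1 ( *%R r2) eB1.
  have /eqP : k0' * (n1 * (r1 - r2)) = 0 by rewrite k20 in eN; lra.
  by rewrite !mulf_eq0 subr_eq0 (negPf r12) (negPf n10) !orbF => /eqP.
have k10 : k1' = 0.
  have /eqP : k1' * n2 = 0 by rewrite k20 k00 in eB1; lra.
  by rewrite mulf_eq0 (negPf n20) orbF => /eqP.
case=> [[|[|[|]]]]// i3.
- by rewrite -k00; congr k; exact/val_inj.
- by rewrite -k10; congr k; exact/val_inj.
- by rewrite -k20; congr k; exact/val_inj.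
Qed.

End Helix.

(** * Classification of the general unit fields *)

Definition unit_scale (R : realType) (r : R) : R := (Num.sqrt (1 + r ^+ 2))^-1.

Definition ratio_field (R : realType) (T N B1 : R -> 'E41[R]) (k2 r : R) :
    R -> 'E41[R] :=
  field_of T N B1 (unit_scale r * k2) (unit_scale r * r) (unit_scale r).

Lemma unit_scale_neq0 (R : realType) (r : R) : unit_scale r != 0.
Proof.
by rewrite invr_eq0 sqrtr_eq0 -ltNge ltr_pwDl// sqr_ge0.
Qed.

Lemma unit_scale_sqr (R : realType) (r : R) :
  unit_scale r ^+ 2 * (1 + r ^+ 2) = 1.
Proof.
have r_ge0 : 0 < 1 + r ^+ 2 by rewrite ltr_pwDl// sqr_ge0.
by rewrite exprVn sqr_sqrtr ?(ltW r_ge0)// mulVf// gt_eqF.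
Qed.

(** Once [r] is given, [mu0 = r nu0] and [nu0^2 (1 + r^2) = 1], so that only
    the sign of [nu0] remains free. *)
Lemma general_unit_fieldE (R : realType) (I : interval R)
    (T N B1 : R -> 'E41[R]) (k2 k3 r : R) (V : R -> 'E41[R]) :
  general_unit_field I T N B1 k2 k3 r V <->
  root_eq k2 k3 r /\ eq_field_up_to_sign I V (ratio_field T N B1 k2 r).
Proof.
have opp_field l m n s : - field_of T N B1 l m n s =
    field_of T N B1 (- l) (- m) (- n) s.
  by rewrite /field_of !scaleNr !opprD.
split=> [[l [m [n [[n0 mn -> rE rr] VE]]]]|[rr VE]].
  split=> //.
  have mE : m = n * r by rewrite rE mulrC divfK.
  have : n ^+ 2 == unit_scale r ^+ 2.
    rewrite -(inj_eq (mulIf (_ : 1 + r ^+ 2 != 0))) ?unit_scale_sqr.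
      by rewrite -[X in _ == X]mn mE; apply/eqP; ring.
    by rewrite gt_eqF// ltr_pwDl// sqr_ge0.
  rewrite eqf_sqr => /orP[]/eqP nE; [left|right] => s sI.
    by rewrite VE// /ratio_field mE -nE.
  by rewrite VE// /ratio_field opp_field mE -!mulNr -nE.
have u0 := unit_scale_neq0 r; have u2 := unit_scale_sqr r.
case: VE => VE.
  exists (unit_scale r * k2), (unit_scale r * r), (unit_scale r); split=> //.
  by split=> //; [rewrite -u2; ring|rewrite mulrC mulKf].
exists (- unit_scale r * k2), (- unit_scale r * r), (- unit_scale r); split.
  by split; rewrite ?oppr_eq0 ?sqrrN// ?[_ / - _]mulrC ?mulKf ?oppr_eq0//
    -u2; ring.
by move=> s sI; rewrite VE// /ratio_field opp_field !mulNr.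
Qed.

(** The discriminant [k2^4 + 4 k3^2] is positive. *)
Lemma root_eq_pair (R : realType) (k2 k3 : R) : k3 != 0 ->
  exists r1 r2 : R,
    (forall r, root_eq k2 k3 r <-> (r = r1 \/ r = r2)) /\ r1 * r2 = -1.
Proof.
move=> k30; pose D := Num.sqrt (k2 ^+ 4 + 4 * k3 ^+ 2).
have D2 : D ^+ 2 = k2 ^+ 4 + 4 * k3 ^+ 2.
  rewrite sqr_sqrtr//; have := sqr_ge0 (k2 ^+ 2); have := sqr_ge0 k3; lra.
pose r1 := (- k2 ^+ 2 + D) / (2 * k3); pose r2 := (- k2 ^+ 2 - D) / (2 * k3).
have r1r2 : r1 * r2 = -1.
  have -> : r1 * r2 = (k2 ^+ 4 - D ^+ 2) / (4 * k3 ^+ 2) by rewrite /r1 /r2; field.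
  by rewrite D2; field.
have r12 : k3 * (r1 + r2) = - k2 ^+ 2 by rewrite /r1 /r2; field.
exists r1, r2; split=> // r.
have rE : k3 * r ^+ 2 + k2 ^+ 2 * r - k3 = k3 * ((r - r1) * (r - r2)).
  have -> : k3 * ((r - r1) * (r - r2)) =
    k3 * r ^+ 2 - k3 * (r1 + r2) * r + k3 * (r1 * r2) by ring.
  by rewrite r12 r1r2; ring.
rewrite /root_eq rE; split=> [/eqP|[]->]; last 2 first.
- by rewrite subrr mul0r mulr0.
- by rewrite subrr !mulr0.
by rewrite !mulf_eq0 (negPf k30) !subr_eq0 /= => /orP[]/eqP ->; [left|right].
Qed.

Theorem proposition4 (R : realType) (I : interval R)
    (alpha T N B1 B2 : R -> 'E41[R]) (k2 k3 l0 : R)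
    (helix : null_cartan_helix I alpha T N B1 B2 k2 k3)
    (k2_neq0 : k2 != 0) (k3_neq0 : k3 != 0) (l0_neq0 : l0 != 0) :
  exists (r1 r2 : R) (V1 V2 : R -> 'E41[R]),
    (* (1) *)
    ([/\ (forall r, root_eq k2 k3 r <-> (r = r1 \/ r = r2)) /\ r1 * r2 = -1,
         general_unit_field I T N B1 k2 k3 r1 V1 /\
         general_unit_field I T N B1 k2 k3 r2 V2,
         is_axis I T N B1 V1 /\ is_axis I T N B1 V2,
         (forall V, (exists r, general_unit_field I T N B1 k2 k3 r V) <->
            (eq_field_up_to_sign I V V1 \/ eq_field_up_to_sign I V V2)) /\
         ~ eq_field_up_to_sign I V1 V2 &
         forall s, s \in I -> mink (V1 s) (V2 s) = 0]) /\
    (* (2) *)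
    (is_axis I T N B1 (type_I_field T N l0) <->
       k3 ^+ 2 = l0 ^+ 2 * (l0 ^+ 2 + k2 ^+ 2)) /\
    (* (3) *)
    (k3 ^+ 2 = l0 ^+ 2 * (l0 ^+ 2 + k2 ^+ 2) ->
       [/\ is_axis I T N B1 V1, is_axis I T N B1 V2,
           is_axis I T N B1 (type_I_field T N l0),
           forall s, s \in I ->
             [/\ free [:: V1 s; V2 s], free [:: V1 s; type_I_field T N l0 s] &
                 free [:: V2 s; type_I_field T N l0 s]] &
           forall s, s \in I -> free [:: V1 s; V2 s; type_I_field T N l0 s]]).
Proof.
have [curve _] := helix; have [r1 [r2 [rr r1r2]]] := root_eq_pair k2 k3_neq0.
have root1 : root_eq k2 k3 r1 by apply/rr; left.
have root2 : root_eq k2 k3 r2 by apply/rr; right.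
have r12 : r1 != r2.
  apply: contra_eq_neq r1r2 => ->; rewrite -expr2 -subr_eq0 opprK.
  by rewrite gt_eqF// ltr_pwDr// sqr_ge0.
pose V r := ratio_field T N B1 k2 r.
have Vaxis r : root_eq k2 k3 r -> is_axis I T N B1 (V r).
  move=> rt; apply: (root_axis curve) => //.
  by rewrite -(unit_scale_sqr r); ring.
have V12 s : s \in I -> mink (V r1 s) (V r2 s) = 0.
  move=> sI; rewrite /V /ratio_field !(field_of_comb _ _ _ B2) (mink_comb curve)//.
  have -> : forall a b : R, a * k2 * 0 + a * r1 * (b * r2) + a * b + 0 * (b * k2) =
    a * b * (r1 * r2 + 1) by move=> a b; ring.
  by rewrite r1r2 addNr mulr0.
have typeI : is_axis I T N B1 (type_I_field T N l0) <->
    k3 ^+ 2 = l0 ^+ 2 * (l0 ^+ 2 + k2 ^+ 2).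
  split; first exact: (type_I_axis_curvature curve).
  exact: (type_I_axis curve).
exists r1, r2, (V r1), (V r2); split; [split=> //|split=> //].
- by split; apply/general_unit_fieldE; split=> //; left.
- by split; apply: Vaxis.
- split=> [W|V12E].
    split=> [[r /general_unit_fieldE[/rr[->|->] WE]]|[] WE]; first by left.
    + by right.
    + by exists r1; apply/general_unit_fieldE.
    + by exists r2; apply/general_unit_fieldE.
  have [s [_ [_ sI _]]] := ncc_nondeg curve.
  have [_ _ /(_ s sI) V11 _] := Vaxis r1 root1.
  move: V11; case: V12E => /(_ s sI) {1}->.
    by rewrite minkC V12// => /eqP; rewrite eq_sym oner_eq0.
  by rewrite minkNl minkC V12// oppr0 => /eqP; rewrite eq_sym oner_eq0.
move=> k3E; have free3 s : s \in I ->
    free [:: V r1 s; V r2 s; type_I_field T N l0 s].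
  by move=> sI; apply: ratio_fields_type_I_free curve _ _ _ _ _ _ sI r12 _ _ l0_neq0;
    exact: unit_scale_neq0.
split=> //; [exact: Vaxis|exact: Vaxis|exact/typeI|].
move=> s /free3; move: (V r1 s) (V r2 s) (type_I_field T N l0 s) => v1 v2 v3 f.
split.
- exact: (catl_free (X := [:: v1; v2]) (Y := [:: v3])).
- apply: (catr_free (X := [:: v2]) (Y := [:: v1; v3])).
  by rewrite -(perm_free (X := [:: v1; v2; v3]))// (perm_catCA [:: v1] [:: v2]).
- exact: (catr_free (X := [:: v1]) (Y := [:: v2; v3])).
Qed.
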